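(* Let $\Lambda=C_{K,L}$ be the $K\times L$ cylindrical grid ($K,L\ge2$, $K$ even) and $(\mathcal X,H,q)$ the hard-core energy landscape on it. Then (a) $\widetilde\Gamma(\mathcal X\setminus\{\mathbf e,\mathbf o\})\le\min\{K/2,L\}$; (b) $\Gamma(\mathbf e,\{\mathbf o\})=\min\{K/2,L\}+1=\widetilde\Gamma(\mathcal X\setminus\{\mathbf o\})$.
   Context: Cylindrical grid $C_{K,L}$: sites $(v_1,v_2)$ with $0\le v_1\le L-1$, $0\le v_2\le K-1$; $v,w$ adjacent iff $|v_1-w_1|+|v_2-w_2|=1$, or $v_1=w_1$ and $\{v_2,w_2\}=\{0,K-1\}$ (each column is a cycle). Even sites: $v_1+v_2$ even. Hard-core landscape: $\mathcal X$ = set of $\sigma\in\{0,1\}^\Lambda$ with $\sigma(v)\sigma(w)=0$ for adjacent $v,w$; $H(\sigma)=-\sum_v\sigma(v)$; $q(\sigma,\sigma')=1/(KL)$ if $\sigma,\sigma'$ differ in exactly one site, $0$ if in more, $q(\sigma,\sigma)=1-\sum_{\eta\ne\sigma}q(\sigma,\eta)$. $\mathbf e$ (resp. $\mathbf o$) has particles exactly at even (resp. odd) sites. Paths: finite sequences with consecutive $q>0$; $\Phi(x,y)$ = minimum over paths from $x$ to $y$ of the maximal $H$ along the path; $\Phi(B,D)=\min_{x\in B,y\in D}\Phi(x,y)$. $\partial B=\{y\notin B:\exists x\in B,q(x,y)>0\}$. A cycle is a nonempty $C$ which is a singleton or a set of at least two elements, connected by paths inside it, with $\max_CH<\min_{\partial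 C}H$; depth $\Gamma(C)=\Phi(C,\mathcal X\setminus C)-\min_CH$. $C_A(x)=\{x\}\cup\{z:\Phi(x,z)<\Phi(x,A)\}$, $\Gamma(x,A)=\Gamma(C_A(x))$. For nonempty $B\subsetneq\mathcal X$, $\widetilde\Gamma(B)=\max\{\Gamma(C):C$ maximal cycle contained in $B\}$. *)

(* Defs.v *)
From Stdlib Require Import ClassicalEpsilon.
From mathcomp Require Import all_boot all_order all_algebra.
Set Implicit Arguments. Unset Strict Implicit. Unset Printing Implicit Defensive.
Import Order.TTheory GRing.Theory Num.Theory.
Local Open Scope ring_scope.

Definition site (K L : nat) := ('I_L * 'I_K)%type.

Definition distn (a b : nat) : nat := if (a <= b)%N then (b - a)%N else (a - b)%N.

Definition grid_adj (K L : nat) (v w : site K L) : bool :=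
  (distn v.1 w.1 + distn v.2 w.2 == 1)%N
  || ((v.1 == w.1)
      && ((((v.2 : nat) == 0%N) && ((w.2 : nat) == K.-1))
          || (((v.2 : nat) == K.-1) && ((w.2 : nat) == 0%N)))).

Definition config (K L : nat) := {ffun site K L -> bool}.

Definition hardcore (K L : nat) (s : config K L) : bool :=
  [forall v, forall w, grid_adj v w ==> ~~ (s v && s w)].

Definition Xset (K L : nat) : {set config K L} := [set s | hardcore s].

Definition Hen (K L : nat) (s : config K L) : int :=
  - \sum_(v : site K L) (nat_of_bool (s v))%:Z.

Definition ndiff (K L : nat) (s t : config K L) : nat := #|[set v | s v != t v]|.

Definition q0 (K L : nat) (s t : config K L) : rat :=
  if ndiff s t == 1%N then ((K * L)%N%:R)^-1 else 0.

Definition q (K L : nat) (s t : config K L) : rat :=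
  if s == t then 1 - \sum_(eta in Xset K L | eta != s) q0 s eta else q0 s t.

Definition trans (K L : nat) (s t : config K L) : bool :=
  [&& s \in Xset K L, t \in Xset K L & 0 < q s t].

Definition is_path (K L : nat) (x y : config K L) (p : seq (config K L)) : Prop :=
  x \in Xset K L /\ path (@trans K L) x p /\ last x p = y.

Definition maxH (K L : nat) (x : config K L) (p : seq (config K L)) : int :=
  \big[Num.max/Hen x]_(z <- p) Hen z.

Definition minval (P : int -> Prop) : int :=
  epsilon (inhabits 0) (fun h => P h /\ forall h', P h' -> h <= h').
Definition maxval (P : int -> Prop) : int :=
  epsilon (inhabits 0) (fun h => P h /\ forall h', P h' -> h' <= h).

Definition Phi (K L : nat) (x y : config K L) : int :=
  minval (fun h => exists p, is_path x y p /\ maxH x p = h).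

Definition PhiS (K L : nat) (B D : {set config K L}) : int :=
  minval (fun h => exists x y, x \in B /\ y \in D /\ Phi x y = h).

Definition bdry (K L : nat) (B : {set config K L}) : {set config K L} :=
  [set y in Xset K L | (y \notin B) && [exists x in B, trans x y]].

Definition is_cycle (K L : nat) (C : {set config K L}) : Prop :=
  C \subset Xset K L /\ C != set0 /\
  (#|C| = 1%N \/
   ((2 <= #|C|)%N /\
    (forall x y, x \in C -> y \in C ->
       exists p, is_path x y p /\ all (fun z => z \in C) p) /\
    (forall x y, x \in C -> y \in bdry C -> Hen x < Hen y))).

Definition minH (K L : nat) (C : {set config K L}) : int :=
  minval (fun h => exists x, x \in C /\ Hen x = h).

Definition depth (K L : nat) (C : {set config K L}) : int :=
  PhiS C (Xset K L :\: C) - minH C.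

Definition CA (K L : nat) (A : {set config K L}) (x : config K L) : {set config K L} :=
  x |: [set z in Xset K L | Phi x z < PhiS [set x] A].

Definition GammaA (K L : nat) (x : config K L) (A : {set config K L}) : int :=
  depth (CA A x).

Definition max_cycle_in (K L : nat) (B C : {set config K L}) : Prop :=
  is_cycle C /\ C \subset B /\
  forall C', is_cycle C' -> C \subset C' -> C' \subset B -> C' = C.

Definition tGamma (K L : nat) (B : {set config K L}) : int :=
  maxval (fun g => exists C, max_cycle_in B C /\ depth C = g).

Definition econf (K L : nat) : config K L := [ffun v : site K L => ~~ odd (v.1 + v.2)].
Definition oconf (K L : nat) : config K L := [ffun v : site K L => odd (v.1 + v.2)].

(* Main.v *)
(* Upper bounds.  Call a site a [b]-site when its coordinate sum has parity [b].
   Rank the sites by column, or by row with the first two rows both of rank 0.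
   Every [b]-site [v] of positive rank has a neighbour [pr v] all of whose other
   neighbours have smaller rank.  Once the [b]-particles of rank 0 are gone, one
   can therefore repeatedly move a [b]-particle of least rank from [v] to [pr v],
   never climbing by more than 1, until only the other parity is left.  At most
   K/2 (resp. L) particles have rank 0, so for one of the two parities at most
   one less than that many have to be removed first.

   Lower bound.  Let m = min(K/2, L) and let the deficit of a configuration be
   KL/2 minus its number of particles.  If the deficit is less than m, then some
   column and some pair of adjacent rows are full, hence agree with a
   checkerboard; as they cross, it is the same one, and it does not change along
   steps of deficit less than m.  To switch, a path of deficit at most m would
   pass through some t such that t + v and t + w have opposite types.  Such a t
   contains no full column and no full pair of rows; so in t + v the column of v,
   and in t + w the row of w together with the two adjacent rows, are full of
   opposite types, although they meet in a site other than v and w. *)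
From Stdlib Require Import ClassicalEpsilon.
Require Import Defs.
From mathcomp Require Import all_boot all_order all_algebra zify.
Set Implicit Arguments. Unset Strict Implicit. Unset Printing Implicit Defensive.
Import Order.TTheory GRing.Theory Num.Theory.
Local Open Scope ring_scope.


(** * Extrema of bounded sets of integers *)

Lemma int_has_min (P : int -> Prop) (B : int) :
  (exists h, P h) -> (forall h, P h -> B <= h) ->
  exists h, P h /\ forall h', P h' -> h <= h'.
Proof.
move=> [h Ph] lb; have [n] := ubnP `|h - B|%N.
elim: n h Ph => // n IH h Ph ltn.
case: (classic (exists h', P h' /\ h' < h)) => [[h' [Ph' lth]]|nex].
  by apply: (IH h') => //; have := lb _ Ph'; have := lb _ Ph; lia.
exists h; split=> // h' Ph'; rewrite leNgt; apply/negP => lt.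
by apply: nex; exists h'.
Qed.

(** [minval] is picked by [epsilon] and says nothing until a minimum is known to exist; nonemptiness
    and a lower bound supply one. *)
Lemma minvalP (P : int -> Prop) (B : int) :
  (exists h, P h) -> (forall h, P h -> B <= h) ->
  P (minval P) /\ forall h, P h -> minval P <= h.
Proof.
move=> exP lb.
exact: (epsilon_spec (inhabits (0 : int)) _ (int_has_min exP lb)).
Qed.

Lemma maxvalP (P : int -> Prop) (B : int) :
  (exists h, P h) -> (forall h, P h -> h <= B) ->
  P (maxval P) /\ forall h, P h -> h <= maxval P.
Proof.
move=> [h Ph] ub; apply: (epsilon_spec (inhabits (0 : int))
  (fun g => P g /\ forall h', P h' -> h' <= g)).
have [||g [Pg ming]] := @int_has_min (fun g => P (- g)) (- B).
- by exists (- h); rewrite opprK.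
- by move=> g /ub; lia.
exists (- g); split=> // h' Ph'.
by have := ming (- h'); rewrite opprK => /(_ Ph'); lia.
Qed.

(** * Single-site updates, transitions and communication heights *)

Section Landscape.
Variables K L : nat.
Local Notation conf := (config K L).
Local Notation X := (Xset K L).
Implicit Types (s t x y z : conf) (v w u : site K L) (B C D : {set conf}) (h : int).

Definition npart s : nat := (\sum_v s v)%N.

Lemma HenE s : Hen s = - (npart s)%:Z.
Proof. by rewrite /Hen /npart (big_morph Posz PoszD (erefl (Posz 0))). Qed.

Definition upd s v b : conf := [ffun w => if w == v then b else s w].

Lemma updE s v b w : upd s v b w = if w == v then b else s w.
Proof. by rewrite ffunE. Qed.

Lemma npart_upd s v b : (npart (upd s v b) + s v = npart s + b)%N.
Proof.
rewrite /npart (bigD1 v) //= [in RHS](bigD1 v) //= updE eqxx.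
rewrite (eq_bigr (fun w => nat_of_bool (s w))) => [|w /negPf ne].
  by rewrite -addnA addnC (addnC _ (nat_of_bool (s v))).
by rewrite updE ne.
Qed.

Lemma npart_le s : (npart s <= #|{: site K L}|)%N.
Proof. by rewrite -sum1_card; apply: leq_sum => v _; case: (s v). Qed.

Lemma Hen_remove s v : s v -> Hen (upd s v false) = Hen s + 1.
Proof. by move=> sv; have := npart_upd s v false; rewrite !HenE sv; lia. Qed.

Lemma Hen_add s v : s v = false -> Hen (upd s v true) + 1 = Hen s.
Proof. by move=> sv; have := npart_upd s v true; rewrite !HenE sv; lia. Qed.

Lemma Hen_le0 s : Hen s <= 0.
Proof. by rewrite HenE; lia. Qed.

Lemma XsetP s :
  reflect (forall v w, grid_adj v w -> s v -> s w -> False) (s \in X).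
Proof.
rewrite inE; apply: (iffP forallP) => [hc v w a sv sw|hc v].
  by have := forallP (hc v) w; rewrite a sv sw.
apply/forallP => w; apply/implyP => a; apply/negP => /andP[sv sw].
exact: hc a sv sw.
Qed.

Lemma Xset_sub s t : (forall v, t v -> s v) -> s \in X -> t \in X.
Proof.
move=> sub /XsetP hc; apply/XsetP => v w a tv tw.
exact: hc a (sub _ tv) (sub _ tw).
Qed.

Lemma ndiffC s t : ndiff s t = ndiff t s.
Proof.
rewrite /ndiff; congr #|pred_of_set _|; apply/setP => v.
by rewrite !inE eq_sym.
Qed.

Lemma transC : symmetric (@trans K L).
Proof.
move=> s t; rewrite /trans /q /q0 ndiffC (eq_sym t s).
by case: eqP => [->|_] //; rewrite andbCA.
Qed.

Lemma trans_Xl s t : trans s t -> s \in X.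
Proof. by case/and3P. Qed.

Lemma trans_Xr s t : trans s t -> t \in X.
Proof. by case/and3P. Qed.

Lemma trans_upd s v b :
  s \in X -> upd s v b \in X -> b != s v -> trans s (upd s v b).
Proof.
move=> Xs Xu ne; rewrite /trans Xs Xu /q /=.
have -> : (s == upd s v b) = false.
  by apply/negP => /eqP/ffunP/(_ v); rewrite updE eqxx => e; rewrite e eqxx in ne.
rewrite /q0; have -> : ndiff s (upd s v b) = 1%N.
  rewrite /ndiff (_ : [set _ | _] = [set v]) ?cards1 //.
  apply/setP => w; rewrite !inE updE; case: (eqVneq w v) => [->|_].
    by rewrite eq_sym.
  by rewrite eqxx.
have := ltn_ord v.1; have := ltn_ord v.2.
by rewrite eqxx invr_gt0 ltr0n muln_gt0 /=; lia.
Qed.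

Lemma trans_inv s t : trans s t -> t = s \/ exists v, t = upd s v (~~ s v).
Proof.
case/and3P => _ _; rewrite /q; case: eqP => [->|_]; first by left.
rewrite /q0; case: eqP => // /eqP/cards1P[v /setP dv] _; right; exists v.
apply/ffunP => w; rewrite updE; have := dv w; rewrite !inE.
case: (eqVneq w v) => [->|_]; first by case: (s v); case: (t v).
by case: (s w); case: (t w).
Qed.

(** Boolean form of [Phi x y <= h] for admissible [x] and [y]. The first two conjuncts matter for
    the empty path, since [connect] relates [x] to itself whatever its energy. *)
Definition reach h x y :=
  [&& x \in X, Hen x <= h &
    connect [rel s t | [&& trans s t, Hen s <= h & Hen t <= h]] x y].

Lemma reach_Xl h x y : reach h x y -> x \in X.
Proof. by case/and3P. Qed.

Lemma reach_Hl h x y : reach h x y -> Hen x <= h.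
Proof. by case/and3P. Qed.

Lemma reach_refl h x : x \in X -> Hen x <= h -> reach h x x.
Proof. by move=> Xx hx; rewrite /reach Xx hx connect0. Qed.

Lemma reach1 h x y : trans x y -> Hen x <= h -> Hen y <= h -> reach h x y.
Proof.
move=> xy hx hy; rewrite /reach (trans_Xl xy) hx.
by apply: connect1; rewrite /= xy hx.
Qed.

Lemma reach_trans h : transitive (reach h).
Proof.
move=> y x z /and3P[Xx hx xy] /and3P[_ _ yz].
by rewrite /reach Xx hx (connect_trans xy yz).
Qed.

Lemma reach_le h h' x y : h <= h' -> reach h x y -> reach h' x y.
Proof.
move=> le /and3P[Xx hx xy]; rewrite /reach Xx (le_trans hx le) /=.
apply: connect_sub xy => s t /= /and3P[st hs ht].
by apply: connect1; rewrite /= st (le_trans hs le) (le_trans ht le).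
Qed.

Lemma maxH_le h x p : (maxH x p <= h) = (Hen x <= h) && all (fun z => Hen z <= h) p.
Proof.
rewrite /maxH; elim: p => [|z p IH]; first by rewrite big_nil andbT.
by rewrite big_cons ge_max IH /= andbCA.
Qed.

Lemma reachP h x y :
  reflect (exists p, is_path x y p /\ maxH x p <= h) (reach h x y).
Proof.
apply: (iffP and3P) => [[Xx hx /connectP[p pp ->]]|[p [[Xx [pp <-]]]]].
  exists p; split.
    by split=> //; split=> //; apply: sub_path pp => s t /and3P[].
  rewrite maxH_le hx /=; elim: p x pp {Xx hx} => //= z p IH x.
  by case/andP => /and3P[_ _ ->] /IH.
rewrite maxH_le => /andP[hx hp]; split=> //; apply/connectP; exists p => //.
elim: p x hx hp pp {Xx} => //= z p IH x hx /andP[hz hp] /andP[-> zp].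
by rewrite hx hz /= IH.
Qed.

Lemma reachC h x y : reach h x y = reach h y x.
Proof.
suff imp : forall x y, reach h x y -> reach h y x by apply/idP/idP; exact: imp.
move=> {x y} x y xy; case/and3P: (xy) => Xx hx cxy.
have [Xy hy] : y \in X /\ Hen y <= h.
  case/connectP: cxy => p; case/lastP: p => [|p z] pp -> //=.
  rewrite last_rcons; move: pp; rewrite rcons_path => /andP[_ /=].
  by case/and3P => /trans_Xr.
rewrite /reach Xy hy /= sym_connect_sym // => s t /=.
by rewrite transC andbCA andbC -andbA andbCA -andbA.
Qed.

Lemma reach_Xr h x y : reach h x y -> y \in X.
Proof. by rewrite reachC => /reach_Xl. Qed.

Lemma reach_Hr h x y : reach h x y -> Hen y <= h.
Proof. by rewrite reachC => /reach_Hl. Qed.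

Definition conf0 : conf := [ffun => false].

(** Particles can be deleted one at a time, and no energy exceeds 0. Through the empty configuration
    any two admissible configurations are joined, so the minimum defining [Phi] ranges over a
    nonempty set. *)
Lemma reach_conf0 x : x \in X -> reach 0 x conf0.
Proof.
have [n] := ubnP (npart x); elim: n x => // n IH x ltn Xx.
have [v xv|x0] := pickP x; last first.
  have -> : conf0 = x by apply/ffunP => v; rewrite ffunE x0.
  by rewrite reach_refl // Hen_le0.
have sub w : upd x v false w -> x w by rewrite updE; case: eqP.
have Xu := Xset_sub sub Xx.
apply: (@reach_trans _ (upd x v false)); last first.
  by apply: IH => //; have := npart_upd x v false; rewrite xv; lia.
by apply: reach1; rewrite ?Hen_le0 ?trans_upd ?xv.
Qed.

Lemma reach_all x y : x \in X -> y \in X -> reach 0 x y.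
Proof.
move=> Xx Xy; apply: (reach_trans (reach_conf0 Xx)).
by rewrite reachC reach_conf0.
Qed.

Lemma maxH_ge x p : Hen x <= maxH x p.
Proof. by have := lexx (maxH x p); rewrite maxH_le => /andP[]. Qed.

Lemma Phi_le h x y : x \in X -> y \in X -> reflect (Phi x y <= h) (reach h x y).
Proof.
move=> Xx Xy; suff E : reach h x y <-> Phi x y <= h.
  by apply: (iffP idP) => /E.
have [||[p [px pE]] minP] := @minvalP
  (fun h => exists p, is_path x y p /\ maxH x p = h) (Hen x).
- by case/reachP: (reach_all Xx Xy) => p [px _]; exists (maxH x p), p.
- by move=> g [p [_ <-]]; exact: maxH_ge.
split=> [/reachP[p' [px' le]]|le].
  by apply: le_trans le; apply: minP; exists p'.
by apply/reachP; exists p; split=> //; rewrite pE.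
Qed.

Lemma PhiS_le h B D : B \subset X -> D \subset X -> B != set0 -> D != set0 ->
  (exists x y, [/\ x \in B, y \in D & reach h x y]) <-> PhiS B D <= h.
Proof.
move=> /subsetP BX /subsetP DX /set0Pn[x0 Bx0] /set0Pn[y0 Dy0].
have [||[x [y [Bx [Dy E]]]] minP] := @minvalP
  (fun h => exists x y, x \in B /\ y \in D /\ Phi x y = h) (- (#|{: site K L}|)%:Z).
- by exists (Phi x0 y0), x0, y0.
- move=> g [x [y [Bx [Dy <-]]]].
  have := introT (Phi_le _ (BX _ Bx) (DX _ Dy)) (lexx _) => /reach_Hl.
  by rewrite HenE; have := npart_le x; lia.
split=> [[x' [y' [Bx' Dy' /Phi_le r]]]|le].
  by apply: le_trans (r (BX _ Bx') (DX _ Dy')); apply: minP; exists x', y'.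
exists x, y; split=> //; apply/(Phi_le h (BX _ Bx) (DX _ Dy)).
by rewrite E.
Qed.

Lemma minHP C : C != set0 ->
  exists x, [/\ x \in C, minH C = Hen x & forall y, y \in C -> Hen x <= Hen y].
Proof.
move=> /set0Pn[x0 Cx0].
have [||[x [Cx E]] minP] := @minvalP
  (fun h => exists x, x \in C /\ Hen x = h) (- (#|{: site K L}|)%:Z).
- by exists (Hen x0), x0.
- by move=> g [x [_ <-]]; rewrite HenE; have := npart_le x; lia.
exists x; split=> // y Cy; rewrite E.
by apply: minP; exists y.
Qed.
End Landscape.


(** * Cycles and their depths *)

Section Cycles.
Variables K L : nat.
Local Notation conf := (config K L).
Local Notation X := (Xset K L).
Implicit Types (s t x y z : conf) (v w u : site K L) (B C D : {set conf}) (h : int).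

Lemma cycle_set1 x : x \in X -> is_cycle [set x].
Proof.
move=> Xx; split; first by rewrite sub1set.
by split; [apply/set0Pn; exists x; rewrite inE | left; rewrite cards1].
Qed.

Lemma max_cycle_exists B : B \subset X -> B != set0 -> exists C, max_cycle_in B C.
Proof.
move=> BX /set0Pn[x Bx].
(* Excluded middle turns [is_cycle] into a boolean, so that a maximal set above a singleton cycle
   can be taken in a finite type. *)
pose P C := (if excluded_middle_informative (is_cycle C) then true else false)
  && (C \subset B).
have PE C : P C <-> is_cycle C /\ C \subset B.
  rewrite /P; case: excluded_middle_informative => // cy; split=> // -[] //.
have Px : P [set x].
  by apply/PE; split; [apply/cycle_set1/(subsetP BX) | rewrite sub1set].
have [C /maxsetP[/PE[cC CB] maxC] _] := maxset_exists Px.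
exists C; split=> //; split=> // C' cC' CC' C'B.
by apply: maxC => //; apply/PE.
Qed.

(** The hypothesis is applied at a lowest point of [C], where [Hen x] equals [minH C]. *)
Lemma depth_le C g : C \subset X -> C != set0 ->
  (forall x, x \in C -> exists y, [/\ y \in X, y \notin C & reach (Hen x + g) x y]) ->
  depth C <= g.
Proof.
move=> CX C0 out; rewrite /depth; have [x [Cx -> _]] := minHP C0.
have [y [Xy nCy xy]] := out x Cx.
rewrite lerBlDl; apply/PhiS_le => //; first exact: subsetDl.
  by apply/set0Pn; exists y; rewrite inE nCy.
by exists x, y; rewrite inE nCy.
Qed.

Lemma depth_ge C a b g : C \subset X -> a \in C -> b \in X -> b \notin C ->
  (forall x y h, x \in C -> y \in X -> y \notin C -> reach h x y -> Hen a + g <= h) ->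
  g <= depth C.
Proof.
move=> CX Ca Xb nCb out; rewrite /depth.
have C0 : C != set0 by apply/set0Pn; exists a.
have [x [Cx -> mn]] := minHP C0.
have D0 : X :\: C != set0 by apply/set0Pn; exists b; rewrite inE nCb.
have [y [z [Cy]]] := iffRL (PhiS_le _ CX (subsetDl X C) C0 D0) (lexx _).
rewrite inE => /andP[nCz Xz] /(out _ _ _ Cy Xz nCz).
by have := mn _ Ca; lia.
Qed.

(** A uniform bound on depths, together with the existence of a maximal cycle, ensures that the
    maximum chosen by [maxval] is attained. *)
Lemma tGammaP B g : B \subset X -> B != set0 ->
  (forall C, C \subset B -> C != set0 -> depth C <= g) ->
  tGamma B <= g /\ forall C, max_cycle_in B C -> depth C <= tGamma B.
Proof.
move=> BX B0 bound.
have le C : max_cycle_in B C -> depth C <= g.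
  by case=> -[_ [C0 _]] [CB _]; exact: bound.
have [||[C [mC dC]] mx] := @maxvalP
  (fun g => exists C, max_cycle_in B C /\ depth C = g) g.
- by have [C mC] := max_cycle_exists BX B0; exists (depth C), C.
- by move=> g' [C [mC <-]]; exact: le.
split; first by rewrite /tGamma -dC; exact: le.
by move=> C' mC'; apply: mx; exists C'.
Qed.

(** The first point of the path outside [C] lies in the boundary. *)
Lemma reach_exit h x y C : reach h x y -> x \in C -> y \notin C ->
  exists2 z, z \in bdry C & Hen z <= h.
Proof.
case/reachP => p [[_ [pp <-]]]; rewrite maxH_le => /andP[_ hp].
elim: p x pp hp => [x _ _ -> //|z p IH x /= /andP[xz pp] /andP[hz hp] Cx nCy].
have [Cz|nCz] := boolP (z \in C); first exact: IH pp hp Cz nCy.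
exists z => //; rewrite /bdry in_set nCz (trans_Xr xz) /=.
by apply/existsP; exists x; rewrite Cx.
Qed.

(** * A lowest configuration [e] separated from [o] by a barrier of height [m + 1] *)

Variables (e o : conf) (m : int).
Hypotheses (Xe : e \in X) (Xo : o \in X) (m_ge0 : 0 <= m).
Hypothesis e_min : forall x, x \in X -> Hen e <= Hen x.
Hypothesis e_to_o : reach (Hen e + m + 1) e o.
Hypothesis barrier : forall h, reach h e o -> Hen e + m + 1 <= h.
Hypothesis to_eo : forall x, x \in X -> reach (Hen x + m) x e \/ reach (Hen x + m) x o.

Let T : int := Hen e + m + 1.

(** By [e_to_o] and [barrier] the communication height of [e] and [o] is exactly [T]; as heights are
    integers, below [T] means at most [T - 1]. *)
Lemma CA_reach : CA [set o] e = [set z | reach (T - 1) e z].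
Proof.
have ->: CA [set o] e = e |: [set z in X | Phi e z < T].
  rewrite /CA; congr (_ |: _); apply/setP => z; rewrite !inE; congr (_ && (_ < _)).
  have E h : reach h e o <-> PhiS [set e] [set o] <= h.
    rewrite -PhiS_le ?sub1set //; try by apply/set0Pn; eexists; rewrite inE.
    split=> [r|[x [y [/set1P-> /set1P->]]] //].
    by exists e, o; rewrite !inE.
  apply/eqP; rewrite eq_le; apply/andP; split; first exact/E.
  by apply: barrier; apply/E.
apply/setP => z; rewrite !inE.
have [->|_] := eqVneq z e; first by rewrite reach_refl // /T; lia.
have [Xz|nXz] := boolP (z \in X).
  move: (Xz); rewrite inE => -> /=.
  rewrite (_ : (_ < T) = (Phi e z <= T - 1)); last by lia.
  by apply/idP/idP => /Phi_le; [exact|apply].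
rewrite inE in nXz; rewrite (negPf nXz) /=; apply/esym/negP => /reach_Xr.
by rewrite inE (negPf nXz).
Qed.

Let C0 : {set conf} := [set z | reach (T - 1) e z].

Lemma C0_X : C0 \subset X.
Proof. by apply/subsetP => z; rewrite inE => /reach_Xr. Qed.

Lemma C0_e : e \in C0.
Proof. by rewrite inE reach_refl // /T; lia. Qed.

Lemma C0_o : o \notin C0.
Proof. by rewrite inE; apply/negP => /barrier; rewrite /T; lia. Qed.

Lemma C0_out x y h : x \in C0 -> y \in X -> y \notin C0 -> reach h x y -> T <= h.
Proof.
rewrite !inE => ex _ ney xy; rewrite leNgt; apply/negP => lt.
move/negP: ney; apply; apply: (reach_trans ex); apply: reach_le xy; lia.
Qed.

(** A path from a point of [C0] at height [T - 1] never leaves [C0], since each of its points is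
    again reached from [e] at that height. A boundary point of energy below [T] would belong to [C0]
    for the same reason. *)
Lemma C0_cycle : is_cycle C0.
Proof.
have nC0 : C0 != set0 by apply/set0Pn; exists e; exact: C0_e.
split; first exact: C0_X.
split=> //; case: (eqVneq #|C0| 1%N) => [|ne1]; [by left | right].
split; first by move: nC0 ne1; rewrite -card_gt0; lia.
split=> [x y|x y Cx].
  rewrite !inE => ex ey; have xy : reach (T - 1) x y.
    by rewrite reachC in ex; exact: reach_trans ex ey.
  case/reachP: (xy) => p [px]; rewrite maxH_le => /andP[hx hp]; exists p; split=> //.
  case: px => _ [pp _] {xy}.
  elim: p x ex hx pp hp => //= z p IH x ex hx /andP[xz pz] /andP[hz hp].
  have ez : reach (T - 1) e z by apply: (reach_trans ex); exact: reach1.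
  by rewrite inE ez /=; exact: (IH z).
rewrite inE => /and3P[Xy nCy /existsP[x' /andP[Cx' xy]]].
apply: (@lt_le_trans _ _ T); first by move: Cx; rewrite inE => /reach_Hr; lia.
rewrite leNgt; apply/negP => lt.
have : T <= T - 1; last by lia.
apply: (C0_out Cx' Xy nCy); apply: reach1 => //; last by lia.
by move: Cx'; rewrite inE => /reach_Hr.
Qed.

(** A cycle [C] containing [C0] but not [o] is left by a path to [o] at height [T], so its boundary
    has a point of energy at most [T]. Unless [C] is a singleton, all its points then lie strictly
    below [T] and are joined to [e] inside [C], hence belong to [C0]. *)
Lemma C0_max : max_cycle_in (X :\: [set o]) C0.
Proof.
split; first exact: C0_cycle.
split; first by rewrite subsetD C0_X disjoint_sym disjoints1 C0_o.
move=> C [CX [nC cyc]] sub /subsetDP[_]; rewrite disjoint_sym disjoints1 => nCo.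
have Ce : e \in C by apply: (subsetP sub); exact: C0_e.
apply/eqP; rewrite eqEsubset sub andbT; apply/subsetP => x Cx.
case: cyc => [C1|[_ [conn low]]].
  by move/eqP/cards1P: C1 Cx Ce => [a ->] /set1P-> /set1P<-; exact: C0_e.
have [b Cb hbridge] := reach_exit e_to_o Ce nCo.
have [p [px /allP allp]] := conn _ _ Ce Cx.
rewrite inE; apply/reachP; exists p; split=> //.
have lt z : z \in C -> Hen z <= T - 1.
  by move=> Cz; have := low _ _ Cz Cb; move: hbridge; rewrite /T; lia.
by rewrite maxH_le lt //; apply/allP => z /allp; exact: lt.
Qed.

Lemma depth_C0_ge : m + 1 <= depth C0.
Proof.
apply: (depth_ge C0_X C0_e Xo C0_o) => x y h Cx Xy nCy xy.
by rewrite addrA; exact: C0_out xy.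
Qed.

(** If only [e] is within reach, the path continues from [e] to [o]: minimality of [Hen e] keeps
    that second leg within [Hen x + (m + 1)]. *)
Lemma to_o x : x \in X -> reach (Hen x + (m + 1)) x o.
Proof.
move=> Xx; have [r|r] := to_eo Xx; last by apply: reach_le r; lia.
apply: (@reach_trans _ _ _ e); first by apply: reach_le r; lia.
by apply: reach_le e_to_o; have := e_min Xx; lia.
Qed.

Lemma depth_le_o C : C \subset X :\: [set o] -> C != set0 -> depth C <= m + 1.
Proof.
case/subsetDP => CX; rewrite disjoint_sym disjoints1 => nCo C0'.
by apply: depth_le => // x /(subsetP CX) Xx; exists o; split=> //; exact: to_o.
Qed.

Lemma GammaA_eo : GammaA e [set o] = m + 1.
Proof.
apply/eqP; rewrite /GammaA CA_reach eq_le depth_C0_ge andbT.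
apply: depth_le_o; first by case: C0_max => _ [].
by apply/set0Pn; exists e; exact: C0_e.
Qed.

Lemma tGamma_o : tGamma (X :\: [set o]) = m + 1.
Proof.
have [||//|le ge] := @tGammaP (X :\: [set o]) (m + 1); first exact: subsetDl.
- apply/set0Pn; exists e; rewrite inE Xe andbT inE.
  by apply: contra C0_o => /eqP <-; exact: C0_e.
- exact: depth_le_o.
by apply/eqP; rewrite eq_le le; exact: le_trans depth_C0_ge (ge _ C0_max).
Qed.

Lemma tGamma_eo : conf0 K L != e -> conf0 K L != o ->
  tGamma (X :\: [set e; o]) <= m.
Proof.
move=> ne no; have sub : X :\: [set e; o] \subset X by exact: subsetDl.
have [||//] := @tGammaP (X :\: [set e; o]) m sub.
- apply/set0Pn; exists (conf0 K L); rewrite !inE negb_or ne no /=.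
  by have := reach_Xr (reach_conf0 Xe); rewrite inE.
- move=> C /subsetDP[CX /disjointFr dis] nC.
  apply: depth_le => // x /(subsetP CX) Xx.
  by have [r|r] := to_eo Xx; [exists e|exists o]; split=> //;
    apply/negP => /dis; rewrite !inE eqxx ?orbT.
Qed.
End Cycles.


(** * Parity, checkerboards and sweeping on the grid *)

Lemma distnE m n : distn m n = ((m - n) + (n - m))%N.
Proof. by rewrite /distn; case: leqP; lia. Qed.

Section Grid.
Variables K L : nat.
Hypotheses (K_ge2 : (2 <= K)%N) (K_even : ~~ odd K).
Local Notation conf := (config K L).
Local Notation X := (Xset K L).
Implicit Types (s t x y z : conf) (v w u : site K L) (b : bool).

Definition par v : bool := odd (v.1 + v.2).

Definition chk b : conf := [ffun v => par v == b].

Lemma econfE : econf K L = chk false.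
Proof. by apply/ffunP => v; rewrite !ffunE eqbF_neg. Qed.

Lemma oconfE : oconf K L = chk true.
Proof. by apply/ffunP => v; rewrite !ffunE eqb_id. Qed.

Lemma grid_adjC : symmetric (@grid_adj K L).
Proof.
move=> [v1 v2] [w1 w2]; rewrite /grid_adj !distnE /= -!val_eqE /=.
by apply/idP/idP; lia.
Qed.

(** The edge closing a column joins rows [0] and [K - 1], of opposite parity because [K] is even. *)
Lemma grid_adj_par v w : grid_adj v w -> par w = ~~ par v.
Proof.
case: v w => [v1 v2] [w1 w2]; rewrite /grid_adj !distnE /par /= -!val_eqE /=.
by lia.
Qed.

Lemma grid_adj_irr v : grid_adj v v = false.
Proof. by apply/negP => /grid_adj_par; case: (par v). Qed.

Lemma chk_X b : chk b \in X.
Proof.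
apply/XsetP => v w /grid_adj_par; rewrite !ffunE => -> /eqP <-.
by case: (par v).
Qed.

Lemma Xset_add s u : s \in X -> (forall w, grid_adj u w -> ~~ s w) ->
  upd s u true \in X.
Proof.
move=> /XsetP hc free; apply/XsetP => v w a; rewrite !updE.
case: eqP => [Ev _|_]; case: eqP => [Ew|_].
- by rewrite Ev Ew grid_adj_irr in a.
- by rewrite Ev in a; rewrite (negPf (free _ a)).
- by rewrite Ew grid_adjC in a; rewrite (negPf (free _ a)).
- exact: hc a.
Qed.

(** Sites of one parity are never adjacent, so the missing particles can be added one by one, each
    lowering the energy. *)
Lemma reach_fill b s : (forall v, s v -> par v = b) -> reach (Hen s) s (chk b).
Proof.
have [n] := ubnP (#|{: site K L}| - npart s); elim: n s => // n IH s ltn sub.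
have Xs : s \in X.
  by apply: Xset_sub (chk_X b) => v /sub; rewrite ffunE => ->.
have [v /andP[pv sv]|full] := pickP (fun v => (par v == b) && ~~ s v); last first.
  have <- : s = chk b; last by rewrite reach_refl.
  apply/ffunP => v; rewrite ffunE; have := full v; have := sub v.
  by case: (s v) => [/(_ isT)->|_]; rewrite ?eqxx ?andbT.
have sub' w : upd s v true w -> par w = b.
  by rewrite updE; case: eqP => [-> _|_ /sub //]; exact/eqP.
have Xu : upd s v true \in X.
  by apply: Xset_sub (chk_X b) => w /sub'; rewrite ffunE => ->.
have Nu := npart_upd s v true.
have Hu : Hen (upd s v true) <= Hen s by rewrite -(Hen_add (negbTE sv)) lerDl.
apply: (@reach_trans _ _ _ (upd s v true)).
  by apply: reach1 => //; apply: trans_upd => //; rewrite (negPf sv).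
apply: reach_le Hu _; apply: IH => //.
by have := npart_le (upd s v true); lia.
Qed.

Section Sweep.
Variables (b : bool) (rk : site K L -> nat) (pr : site K L -> site K L).
Hypothesis prP : forall v, par v = b -> (0 < rk v)%N ->
  grid_adj (pr v) v /\ forall w, grid_adj (pr v) w -> w != v -> (rk w < rk v)%N.

Lemma reach_sweep s : s \in X -> (forall v, s v -> par v = b -> (0 < rk v)%N) ->
  reach (Hen s + 1) s (chk (~~ b)).
Proof.
have [n] := ubnP #|[set v | s v && (par v == b)]|.
elim: n s => // n IH s ltn Xs pos.
have [v0 v0P|none] := pickP (fun v => s v && (par v == b)); last first.
  apply: (@reach_le _ _ (Hen s)); first by lia.
  apply: reach_fill => v sv; have := none v; rewrite sv /=.
  by case: (par v) b => [] [].
have [v /andP[sv /eqP pv] vmin] := @arg_minnP _ v0 (fun v => s v && (par v == b)) rk v0P.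
have [uv unb] := prP pv (pos _ sv pv).
set u := pr v in uv unb.
have pu : par u = ~~ b by rewrite -pv (grid_adj_par uv) negbK.
have nuv : (u == v) = false.
  by apply/eqP => E; move: uv; rewrite E grid_adj_irr.
have su : s u = false.
  by apply/negP => su; move/XsetP: Xs => /(_ _ _ uv su sv).
set s1 := upd s v false; set s2 := upd s1 u true.
have X1 : s1 \in X by apply: Xset_sub Xs => w; rewrite updE; case: eqP.
(* The neighbours of [u] other than [v] are [b]-sites of rank below that of [v], the least rank of a
   [b]-particle, hence empty. *)
have X2 : s2 \in X.
  apply: Xset_add => // w uw; rewrite updE; case: eqVneq => //= nwv.
  apply/negP => sw; have := unb _ uw nwv; rewrite ltnNge vmin // sw /=.
  by rewrite (grid_adj_par uw) pu negbK.
have s1u : s1 u = false by rewrite updE nuv.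
have H1 : Hen s1 = Hen s + 1 by exact: Hen_remove.
have H2 : Hen s2 = Hen s by apply: (addIr 1); rewrite -H1; exact: Hen_add.
apply: (@reach_trans _ _ _ s1).
  by apply: reach1; rewrite ?H1 ?trans_upd ?sv ?lexx ?lerDl.
apply: (@reach_trans _ _ _ s2).
  by apply: reach1; rewrite ?H1 ?H2 ?trans_upd ?s1u ?lexx ?lerDl.
rewrite -H2; apply: IH => //.
- rewrite ltnS in ltn; apply: leq_trans ltn; apply: proper_card; apply/properP; split.
    apply/subsetP => w; rewrite !inE !updE; case: eqP => [->|_].
      by rewrite pu; case: (b).
    by case: eqP.
  exists v; rewrite !inE ?sv ?pv ?eqxx // !updE eqxx.
  by rewrite eq_sym nuv.
- move=> w; rewrite !updE; case: eqP => [-> _|_]; first by rewrite pu; case: (b).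
  by case: eqP => // _; exact: pos.
Qed.

(** Each deleted [b]-particle of rank 0 costs 1; the final 1 is the allowance for the sweep. *)
Lemma reach_clear s : s \in X ->
  reach (Hen s + #|[set v | [&& s v, par v == b & rk v == 0%N]]|%:Z + 1) s (chk (~~ b)).
Proof.
move En : #|_| => n; elim: n s En => [|n IH] s En Xs.
  rewrite addr0; apply: reach_sweep => // v sv pv; rewrite lt0n; apply/negP => rv.
  by move/cards0_eq/setP: En => /(_ v); rewrite !inE sv pv rv eqxx.
have /set0Pn[v] : [set v | [&& s v, par v == b & rk v == 0%N]] != set0.
  by rewrite -card_gt0 En.
move=> vin; have := vin; rewrite inE => /and3P[sv pv rv].
set s1 := upd s v false.
have X1 : s1 \in X by apply: Xset_sub Xs => w; rewrite updE; case: eqP.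
have H1 : Hen s1 = Hen s + 1 by exact: Hen_remove.
apply: (@reach_trans _ _ _ s1).
  apply: reach1; rewrite ?trans_upd ?sv //; first by rewrite -addrA lerDl.
  by rewrite H1 lerD2r lerDl.
have -> : Hen s + n.+1%:Z + 1 = Hen s1 + n%:Z + 1 by rewrite H1 intS addrA.
apply: IH => //; move: En; rewrite (cardsD1 v) vin => -[<-].
apply: eq_card => w; rewrite !inE updE.
by case: eqP.
Qed.
End Sweep.
End Grid.


(** * Upper bounds from sweeps by columns and by rows *)

Section Upper.
Variables K L : nat.
Hypotheses (K_ge2 : (2 <= K)%N) (L_ge2 : (2 <= L)%N) (K_even : ~~ odd K).
Local Notation conf := (config K L).
Local Notation X := (Xset K L).
Implicit Types (s t x y z : conf) (v w u : site K L) (b : bool).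

Lemma reach_chk (rk : site K L -> nat) (pr : site K L -> site K L) n s :
  (forall v, (0 < rk v)%N -> grid_adj (pr v) v /\
     forall w, grid_adj (pr v) w -> w != v -> (rk w < rk v)%N) ->
  (0 < n)%N -> s \in X -> (#|[set v | s v & rk v == 0%N]| <= n)%N ->
  (forall b, reach (Hen s + n%:Z + 1) s (chk K L b)) /\
  exists b, reach (Hen s + n%:Z) s (chk K L b).
Proof.
move=> prP n0 Xs; rewrite -(cardsID [set v | par v]).
pose P b := #|[set v | [&& s v, par v == b & rk v == 0%N]]|.
have -> : [set v | s v & rk v == 0%N] :&: [set v | par v] =
    [set v | [&& s v, par v == true & rk v == 0%N]].
  by apply/setP => v; rewrite !inE; case: (s v); case: (par v); rewrite /= ?andbT ?andbF.
have -> : [set v | s v & rk v == 0%N] :\: [set v | par v] =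
    [set v | [&& s v, par v == false & rk v == 0%N]].
  by apply/setP => v; rewrite !inE; case: (s v); case: (par v); rewrite /= ?andbT ?andbF.
rewrite -/(P true) -/(P false) => le.
have r b : reach (Hen s + (P b)%:Z + 1) s (chk K L (~~ b)).
  by apply: (reach_clear K_ge2 K_even (pr := pr)) => // v _; exact: prP.
split=> [b|].
  have := r (~~ b); rewrite negbK; apply: reach_le; rewrite lerD2r lerD2l lez_nat.
  by apply: leq_trans le; case: (b); [exact: leq_addl|exact: leq_addr].
(* The two counts sum to at most [n]. If [P true] uses all of it, [P false] is 0 and the other sweep
   costs [1 <= n]; otherwise [P true + 1 <= n]. *)
have [le'|lt'] := leqP n (P true).
  exists true; apply: reach_le (r false); rewrite -addrA lerD2l.
  by move: le le' n0; clear; lia.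
exists false; apply: reach_le (r true); rewrite -addrA lerD2l.
by move: lt'; clear; lia.
Qed.

Lemma val_ord_pred n (i : 'I_n) : (0 < i)%N -> ord_pred i = i.-1 :> nat.
Proof. by case: i => [[|i] /= lt] // _; rewrite modnDr modn_small; lia. Qed.

Lemma reach_chk_col s : s \in X ->
  (forall b, reach (Hen s + K./2%:Z + 1) s (chk K L b)) /\
  exists b, reach (Hen s + K./2%:Z) s (chk K L b).
Proof.
move=> Xs; apply: (reach_chk (rk := fun v => v.1)
  (pr := fun v => (ord_pred v.1, v.2))) => //; last first.
(* Column 0 splits into [K./2] vertical dominoes, numbered by [f], each holding at most one
   particle. *)
- have half v : (v.2./2 < K./2)%N by case: v => c [r lt] /=; lia.
  pose f v := Ordinal (half v).
  rewrite -(card_in_imset (f := f)); first by rewrite -[leqRHS]card_ord max_card.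
  move=> v w; rewrite !inE => /andP[sv v1] /andP[sw w1] /(congr1 val) /= E.
  apply/eqP/negPn/negP => ne; move/XsetP: Xs => /(_ v w _ sv sw); apply.
  move: v1 w1 ne E {sv sw half f}; case: v w => [v1 v2] [w1 w2].
  by rewrite /grid_adj !distnE xpair_eqE -!val_eqE /=; lia.
- by lia.
- move=> [v1 v2] /= pos; have /= p1 := val_ord_pred pos; split.
    by rewrite /grid_adj !distnE -!val_eqE /= p1; lia.
  move=> [w1 w2]; rewrite /grid_adj !distnE xpair_eqE -!val_eqE /=.
  by rewrite p1; lia.
Qed.

(** The truncated predecessor gives rows 0 and 1 rank 0: particles of row 1 could not be swept into
    row 0, which is also adjacent to row [K - 1]. *)
Lemma reach_chk_row s : s \in X ->
  (forall b, reach (Hen s + L%:Z + 1) s (chk K L b)) /\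
  exists b, reach (Hen s + L%:Z) s (chk K L b).
Proof.
move=> Xs; apply: (reach_chk (rk := fun v => v.2.-1)
  (pr := fun v => (v.1, ord_pred v.2))) => //; last first.
(* Rows 0 and 1 form one vertical domino per column, so their particles lie in distinct columns. *)
- rewrite -(card_in_imset (f := fst)); first by rewrite -[leqRHS]card_ord max_card.
  move=> v w; rewrite !inE => /andP[sv v1] /andP[sw w1] /(congr1 val) /= E.
  apply/eqP/negPn/negP => ne; move/XsetP: Xs => /(_ v w _ sv sw); apply.
  move: v1 w1 ne E {sv sw}; case: v w => [v1 v2] [w1 w2].
  by rewrite /grid_adj !distnE xpair_eqE -!val_eqE /=; lia.
- by lia.
- move=> [v1 v2] /= pos; have /val_ord_pred /= p2 : (0 < v2)%N by lia.
  split.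
    by rewrite /grid_adj !distnE -!val_eqE /= p2; lia.
  move=> [w1 w2]; rewrite /grid_adj !distnE xpair_eqE -!val_eqE /=.
  by rewrite p2; have := ltn_ord v2; lia.
Qed.

Lemma reach_chk_min s : s \in X ->
  (forall b, reach (Hen s + (minn K./2 L)%:Z + 1) s (chk K L b)) /\
  exists b, reach (Hen s + (minn K./2 L)%:Z) s (chk K L b).
Proof.
by rewrite /minn; case: ifP => _; [exact: reach_chk_col | exact: reach_chk_row].
Qed.
End Upper.


(** * Cyclic successors and sums over ordinals *)

Lemma val_ordS n (i : 'I_n) : ordS i = (if i.+1 == n then 0%N else i.+1) :> nat.
Proof.
have := ltn_ord i; case: eqP => [E|ne] lt /=; first by rewrite E modnn.
by rewrite modn_small; lia.
Qed.

Lemma ordS_pred_neq n (i : 'I_n) : (2 < n)%N ->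
  [/\ ordS i != i, ord_pred i != i & ordS i != ord_pred i].
Proof.
move=> n2; have neq (j : 'I_n) : ordS j != j.
  apply/eqP => /(congr1 (@nat_of_ord n)); rewrite val_ordS.
  by have := ltn_ord j; case: eqP; lia.
split=> //; first by rewrite eq_sym -{1}(ord_predK i) neq.
rewrite -{1}(ord_predK i); apply/eqP => /(congr1 (@nat_of_ord n)).
by rewrite !val_ordS; have := ltn_ord (ord_pred i); do 2!case: eqP; lia.
Qed.

Lemma sum_le n (f : 'I_n -> nat) a : (forall i, f i <= a)%N -> (\sum_i f i <= n * a)%N.
Proof.
by move=> le; rewrite -[n in (n * a)%N]card_ord -sum_nat_const; exact: leq_sum.
Qed.

Lemma sum_lt n (f : 'I_n -> nat) a : (forall i, f i <= a)%N ->
  (exists i, f i <> a) -> (\sum_i f i < n * a)%N.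
Proof.
move=> le [i ne]; rewrite -[n in (n * a)%N]card_ord -sum_nat_const.
rewrite (bigD1 i) //= [ltnRHS](bigD1 i) //= -addSn leq_add //.
  by have := le i; lia.
exact: leq_sum.
Qed.

(** * Lower bound: counting particles along vertical edges *)

Section Lower.
Variables K L : nat.
Hypotheses (K_ge2 : (2 <= K)%N) (L_ge2 : (2 <= L)%N) (K_even : ~~ odd K).
Local Notation conf := (config K L).
Local Notation X := (Xset K L).
Implicit Types (s t x y z : conf) (v w u : site K L) (b : bool) (c : 'I_L) (r : 'I_K).

Lemma adj_up c r : grid_adj (c, r) (c, ordS r).
Proof.
rewrite /grid_adj !distnE eqxx; have := val_ordS r; have := ltn_ord r.
by move=> /= lt ->; case: (eqVneq (nat_of_ord r).+1 K); lia.
Qed.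

Lemma par_up c r : par (c, ordS r) = ~~ par (c, r).
Proof. exact: (grid_adj_par K_ge2 K_even (adj_up c r)). Qed.

(** Indexing the cyclic edges by their first row makes every site count twice in a column sum, also
    for [K = 2], where both indices give the same pair of sites. *)
Definition edge s c r : nat := (s (c, r) + s (c, ordS r))%N.

Lemma edge_le1 s c r : s \in X -> (edge s c r <= 1)%N.
Proof.
move=> /XsetP/(_ _ _ (adj_up c r)); rewrite /edge.
by case: (s _); case: (s _) => // /(_ isT isT).
Qed.

Lemma edge_eq1 s c r : edge s c r = 1%N -> s (c, ordS r) = ~~ s (c, r).
Proof. by rewrite /edge; case: (s _); case: (s _). Qed.

Lemma sum_edge_col s c : (\sum_r edge s c r = (\sum_r s (c, r)).*2)%N.
Proof.
rewrite /edge big_split /= -addnn; congr addn.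
by rewrite [RHS](reindex_inj (@ordS_inj K)).
Qed.

Lemma sum_edge s : (\sum_c \sum_r edge s c r = (npart s).*2)%N.
Proof.
rewrite (eq_bigr (fun c => (\sum_r s (c, r)) * 2)%N) => [|c _]; last first.
  by rewrite sum_edge_col muln2.
rewrite -big_distrl /= muln2 /npart pair_bigA /=; congr _.*2.
by apply: eq_bigr => -[].
Qed.

Lemma npart_max s : s \in X -> ((npart s).*2 <= L * K)%N.
Proof.
move=> Xs; rewrite -sum_edge; apply: sum_le => c.
by rewrite -[leqRHS]muln1; apply: sum_le => r; exact: edge_le1.
Qed.

Lemma npart_chk b : ((npart (chk K L b)).*2 = L * K)%N.
Proof.
rewrite -sum_edge (eq_bigr (fun=> K)) => [|c _].
  by rewrite sum_nat_const card_ord.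
rewrite (eq_bigr (fun=> 1%N)) => [|r _].
  by rewrite sum_nat_const card_ord muln1.
by rewrite /edge !ffunE par_up; case: (par _); case: b.
Qed.


(** * Full columns and full pairs of adjacent rows *)

Definition vbridge b c s := forall r, s (c, r) = (par (c, r) == b).

Definition hbridge b r s := forall c,
  s (c, r) = (par (c, r) == b) /\ s (c, ordS r) = (par (c, ordS r) == b).

Lemma vbridge_hbridge b b' c r s : vbridge b c s -> hbridge b' r s -> b = b'.
Proof. by move=> /(_ r) E /(_ c)[]; rewrite E; case: (par _) b b' {E} => [] [] []. Qed.

Lemma vbridge_edge s c : (forall r, edge s c r = 1%N) -> exists b, vbridge b c s.
Proof.
move=> E; have K0 : (0 < K)%N by lia.
pose r0 := Ordinal K0; exists (par (c, r0) == s (c, r0)) => -[n lt].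
elim: n lt => [|n IH] lt.
  rewrite (_ : Ordinal lt = r0); last exact: val_inj.
  by case: (par _); case: (s _).
have lt' : (n < K)%N by lia.
have -> : Ordinal lt = ordS (Ordinal lt').
  by apply: val_inj; have /= -> := val_ordS (Ordinal lt'); case: eqP => //; lia.
rewrite (edge_eq1 (E _)) par_up (IH lt').
by move: (par (c, r0) == s (c, r0)) => B; case: (par _); case: B.
Qed.

(** Exclusion along rows forces neighbouring full vertical edges to carry their particles in
    opposite rows. *)
Lemma hbridge_edge s r : s \in X -> (forall c, edge s c r = 1%N) -> exists b, hbridge b r s.
Proof.
move=> /XsetP hc E; have L0 : (0 < L)%N by lia.
pose c0 := Ordinal L0; pose b := par (c0, r) == s (c0, r).
suff H c : s (c, r) = (par (c, r) == b).
  exists b => c; split=> //; rewrite (edge_eq1 (E _)) par_up H.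
  by case: (par _); case: (b).
case: c => n lt; elim: n lt => [|n IH] lt.
  rewrite (_ : Ordinal lt = c0); last exact: val_inj.
  by rewrite /b; case: (par _); case: (s _).
have lt' : (n < L)%N by lia.
have adj r' : grid_adj (Ordinal lt', r') (Ordinal lt, r').
  by rewrite /grid_adj !distnE /=; lia.
have := hc _ _ (adj r); have := hc _ _ (adj (ordS r)).
rewrite (grid_adj_par K_ge2 K_even (adj r)) !(edge_eq1 (E _)) (IH lt').
move: (s (Ordinal lt, r)) (par _) => S P; clear -S P; clearbody b.
by case: S P b => [] [] [] // h1 h2; do [have := h1 isT isT|have := h2 isT isT].
Qed.

Lemma vbridge_exists s : s \in X -> (L * K + 2 <= (npart s).*2 + L.*2)%N ->
  exists b c, vbridge b c s.
Proof.
move=> Xs le; have [c full|none] := pickP (fun c => [forall r, edge s c r == 1%N]).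
  have [b vbc] := @vbridge_edge s c (fun r => eqP (forallP full r)).
  by exists b, c.
have : (\sum_c \sum_r edge s c r <= L * (K - 2))%N.
  apply: sum_le => c; have /negP/negP := none c.
  rewrite negb_forall => /existsP[r /eqP ne].
  (* The column sum is even and less than the even number [K], hence at most [K - 2]. *)
  have := @sum_lt K (edge s c) 1 (fun r => edge_le1 c r Xs) (ex_intro _ r ne).
  by rewrite sum_edge_col muln1; move: K_even K_ge2; clear; lia.
rewrite sum_edge mulnBr; move: le.
have : (L * 2 <= L * K)%N by rewrite leq_mul2l K_ge2 orbT.
by clear; lia.
Qed.

(** If every pair of rows except possibly the one at [r0] missed a particle, twice the deficit would
    be at least [K - 1], while it is assumed at most [K - 2]. This slack is what allows a prescribed
    [r0] to be avoided. *)
Lemma hbridge_exists s r0 : s \in X -> (L * K + 2 <= (npart s).*2 + K)%N ->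
  exists b r, r != r0 /\ hbridge b r s.
Proof.
move=> Xs le.
have [r /andP[ne full]|none] :=
    pickP (fun r => (r != r0) && [forall c, edge s c r == 1%N]).
  have [b hbr] := @hbridge_edge s r Xs (fun c => eqP (forallP full c)).
  by exists b, r.
have : (\sum_r (\sum_c edge s c r + (r != r0)) <= K * L)%N.
  apply: sum_le => r; have := none r; case: eqP => [_ _|_ /= /negP/negP].
    by rewrite addn0 -[leqRHS]muln1; apply: sum_le => c; exact: edge_le1.
  rewrite negb_forall => /existsP[c /eqP ne].
  have := @sum_lt L (edge s ^~ r) 1 (fun c => edge_le1 c r Xs) (ex_intro _ c ne).
  by rewrite muln1 addn1.
rewrite big_split /= exchange_big /= sum_edge.
have : (\sum_r (r != r0) + 1 = K)%N.
  rewrite (bigD1 r0) //= eqxx add0n (eq_bigr (fun=> 1%N)) => [|r ->] //.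
  by rewrite sum1_card cardC1 card_ord; move: K_ge2; clear; lia.
by move: (\sum_i (i != r0))%N le K_ge2 => S; rewrite (mulnC K); clear; lia.
Qed.

(** The edge already carries a particle of [s], so [t] has no room for another one there. *)
Lemma edge_sub b c r s t : (forall v, s v -> t v) -> t \in X ->
  s (c, r) = (par (c, r) == b) -> s (c, ordS r) = (par (c, ordS r) == b) ->
  t (c, r) = (par (c, r) == b) /\ t (c, ordS r) = (par (c, ordS r) == b).
Proof.
move=> sub /XsetP/(_ _ _ (adj_up c r)); have := sub (c, ordS r); have := sub (c, r).
rewrite par_up => s1 s2 t12 E1 E2; move: s1 s2 t12; rewrite E1 E2.
case: (t (c, r)); case: (t _); case: (par _); case: b {E1 E2} => //= h1 h2 h3;
  by [have := h1 isT | have := h2 isT | have := h3 isT isT].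
Qed.

Lemma vbridge_sub b c s t : (forall v, s v -> t v) -> t \in X -> vbridge b c s -> vbridge b c t.
Proof. by move=> sub Xt vbc r; have [] := edge_sub sub Xt (vbc r) (vbc (ordS r)). Qed.

Lemma hbridge_sub b r s t : (forall v, s v -> t v) -> t \in X -> hbridge b r s -> hbridge b r t.
Proof. by move=> sub Xt hbr c; have [E1 E2] := hbr c; exact: edge_sub sub Xt E1 E2. Qed.

(** * Types of nearly full configurations and the barrier *)

Let m := minn K./2 L.

(** Deficit at most [m - 1], doubled to avoid halves. *)
Definition low s := (L * K + 2 <= (npart s).*2 + m.*2)%N.

Definition typ b s := (exists c, vbridge b c s) /\ (exists r, hbridge b r s).

Lemma low_typ s : s \in X -> low s -> exists b, typ b s.
Proof.
move=> Xs ls; have r0 : 'I_K by apply: Ordinal (ltnW K_ge2).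
have [||b [c vbc]] // := @vbridge_exists s; first by apply: leq_trans ls _; rewrite /m; lia.
have [||b' [r [_ hbr]]] // := @hbridge_exists s r0.
  by apply: leq_trans ls _; rewrite /m; lia.
exists b; split; first by exists c.
by rewrite (vbridge_hbridge vbc hbr); exists r.
Qed.

Lemma typ_inj b b' s : typ b s -> typ b' s -> b = b'.
Proof. by case=> [[c vbc] _] [_ [r hbr]]; exact: vbridge_hbridge vbc hbr. Qed.

Lemma typ_sub b s t : (forall v, s v -> t v) -> t \in X -> typ b s -> typ b t.
Proof.
move=> sub Xt [[c vbc] [r hbr]].
by split; [exists c; exact: vbridge_sub vbc|exists r; exact: hbridge_sub hbr].
Qed.

Lemma upd_sub s v w : s w -> upd s v true w.
Proof. by rewrite updE; case: eqP. Qed.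

(** Since [t] has no bridge, those of [t + v] use [v]: the full column is that of [v], and a full
    pair of rows starts at [v.2] or just before it. Excluding either start through [hbridge_exists]
    yields the other, so both pairs, that is three cyclically consecutive rows, are full. *)
Lemma bridges_at b t v : upd t v true \in X -> low (upd t v true) ->
  typ b (upd t v true) ->
  (forall b' c, ~ vbridge b' c t) -> (forall b' r, ~ hbridge b' r t) ->
  (forall r, upd t v true (v.1, r) = (par (v.1, r) == b)) /\
  forall c r, r \in [:: ord_pred v.2; v.2; ordS v.2] ->
    upd t v true (c, r) = (par (c, r) == b).
Proof.
set s := upd t v true => Xs ls [[c vbc] [r1 hbr1]] nvb nhb.
have st w : w != v -> s w = t w by rewrite /s updE => /negPf ->.
have Ec : c = v.1.
  apply/eqP/negPn/negP => ne; apply: (nvb b c) => r; rewrite -st ?vbc //.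
  by apply: contra ne => /eqP <-.
have hbE r : r != v.2 -> r != ord_pred v.2 -> ~ hbridge b r s.
  move=> ne1 ne2 hbr; apply: (nhb b r) => c'; have [<- <-] := hbr c'.
  by split; rewrite st //; [apply: contra ne1|apply: contra ne2] => /eqP <- //=;
    rewrite ordSK.
have ex r0 : exists2 r, r != r0 & hbridge b r s.
  have [||b' [r [ne hbr]]] // := @hbridge_exists s r0.
    by apply: leq_trans ls _; rewrite /m; lia.
  by exists r => //; rewrite (vbridge_hbridge vbc hbr).
have h1 : hbridge b v.2 s.
  have [r ne hbr] := ex (ord_pred v.2); case: (eqVneq r v.2) => [<-//|ne'].
  by case: (hbE r).
have h2 : hbridge b (ord_pred v.2) s.
  have [r ne hbr] := ex v.2; case: (eqVneq r (ord_pred v.2)) => [<-//|ne'].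
  by case: (hbE r).
split=> [r|c' r]; first by rewrite -Ec.
rewrite !inE => /or3P[] /eqP ->; first by case: (h2 c').
  by case: (h1 c').
by case: (h1 c').
Qed.

Lemma no_switch b t v w : t \in X -> t v = false -> t w = false ->
  upd t v true \in X -> upd t w true \in X ->
  low (upd t v true) -> low (upd t w true) ->
  typ b (upd t v true) -> typ (~~ b) (upd t w true) -> False.
Proof.
move=> Xt tv tw X1 X2 l1 l2 ty1 ty2.
(* A bridge of [t] would persist in both [t + v] and [t + w] and force [b = ~~ b]. *)
have nvb b' c : ~ vbridge b' c t.
  move=> vbc; have [_ [r1 h1]] := ty1; have [_ [r2 h2]] := ty2.
  have E1 := vbridge_hbridge (vbridge_sub (@upd_sub t v) X1 vbc) h1.
  have E2 := vbridge_hbridge (vbridge_sub (@upd_sub t w) X2 vbc) h2.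
  by move: E2; rewrite E1; case: (b).
have nhb b' r : ~ hbridge b' r t.
  move=> hbr; have [[c1 h1] _] := ty1; have [[c2 h2] _] := ty2.
  have E1 := vbridge_hbridge h1 (hbridge_sub (@upd_sub t v) X1 hbr).
  have E2 := vbridge_hbridge h2 (hbridge_sub (@upd_sub t w) X2 hbr).
  by move: E2; rewrite -E1; case: (b).
(* [t] has no full column, so its deficit, which is at most K/2, is at least L. *)
have K4 : (2 < K)%N.
  rewrite ltnNge; apply/negP => K2.
  have [|b' [c vbc]] := vbridge_exists Xt; last exact: nvb vbc.
  have := npart_upd t v true; move: l1 L_ge2 K2; rewrite tv /low /m; clear.
  by move: (L * K)%N => LK; lia.
have [col1 _] := bridges_at X1 l1 ty1 nvb nhb.
have [_ row2] := bridges_at X2 l2 ty2 nvb nhb.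
(* Where the column of [v] crosses one of these rows, the two checkerboards disagree, so the
   crossing site is [v] or [w]. *)
have hit r : r \in [:: ord_pred w.2; w.2; ordS w.2] -> r = v.2 \/ r = w.2.
  move=> rin; have := row2 v.1 _ rin; have := col1 r; rewrite !updE.
  case: (eqVneq (v.1, r) v) => [<- _ _|_]; first by left.
  case: (eqVneq (v.1, r) w) => [<- _ _|_ ->]; first by right.
  by case: (par _); case: (b).
have [n1 n2 n3] := ordS_pred_neq w.2 K4.
(* Both cyclic neighbours of row [w.2] would have to be row [v.2], yet they are distinct. *)
have [|E1|E1] := hit (ord_pred w.2); rewrite ?inE ?eqxx //.
  have [|E2|E2] := hit (ordS w.2); rewrite ?inE ?eqxx ?orbT //.
    by rewrite E1 E2 eqxx in n3.
  by rewrite E2 eqxx in n1.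
by rewrite E1 eqxx in n2.
Qed.

(* A configuration one particle short of [low] is typed by the low
   configuration it came from. *)
Definition e_side s := s \in X /\
  ((low s /\ typ false s) \/
   (~~ low s /\ exists v, [/\ s v = false, upd s v true \in X,
      low (upd s v true) & typ false (upd s v true)])).

Lemma e_side_trans s s' : trans s s' -> (L * K <= (npart s').*2 + m.*2)%N ->
  e_side s -> e_side s'.
Proof.
move=> ss' med [Xs side]; have Xs' := trans_Xr ss'.
have [->|[w E]] := trans_inv ss'; first by [].
split=> //; move: E; case: (boolP (s w)) => sw /= E.
  have Ns : npart s = (npart s').+1.
    by have := npart_upd s w false; rewrite -E sw; clear; lia.
  (* If [s] were not [low], removing a particle would push the deficit above [m]. *)
  case: side => [[ls ts]|[nls _]]; last first.
    by move: nls med; rewrite /low Ns; clear; move: (L * K)%N => LK; lia.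
  have s'w : s' w = false by rewrite E updE eqxx.
  have Es : upd s' w true = s.
    by apply/ffunP => u; rewrite E !updE; case: eqP => [->|].
  have [ls'|nls'] := boolP (low s'); [left|right]; split=> //.
    have [b tb] := low_typ Xs' ls'; rewrite -(typ_inj _ ts (b := b)) //.
    by apply: typ_sub tb => // u; rewrite E updE; case: eqP.
  by exists w; rewrite s'w Es.
have Ns : npart s' = (npart s).+1.
  by have := npart_upd s w true; rewrite -E (negPf sw); clear; lia.
case: side => [[ls ts]|[nls [v [sv Xv lv tv]]]]; left.
  split; first by move: ls; rewrite /low Ns; clear; move: (L * K)%N => LK; lia.
  by apply: typ_sub ts => // u su; rewrite E; exact: upd_sub.
have ls' : low s'.
  move: lv; have := npart_upd s v true; rewrite /low Ns sv; clear.
  by move: (L * K)%N => LK; lia.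
split=> //; have [[] tb] := low_typ Xs' ls'; last by [].
(* Type [true] for [s'], which is [s + w], is excluded by the type [false] of [s + v]. *)
case: (@no_switch false s v w) => //; rewrite -?E //; exact: negbTE.
Qed.

(** A lower path would keep the deficit at most [m] and so preserve [e_side], which fails at its
    end: there the configuration is [low] but not of type [false]. *)
Lemma chk_barrier h : reach h (chk K L false) (chk K L true) ->
  Hen (chk K L false) + m%:Z + 1 <= h.
Proof.
move=> r; rewrite leNgt; apply/negP => lt.
have r0 : 'I_K by apply: Ordinal (ltnW K_ge2).
have c0 : 'I_L by apply: Ordinal (ltnW L_ge2).
have vbc b c : vbridge b c (chk K L b) by move=> r'; rewrite ffunE.
have hbr b r' : hbridge b r' (chk K L b) by move=> c; rewrite !ffunE.
have lowc b : low (chk K L b).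
  by rewrite /low npart_chk /m; move: K_ge2 L_ge2; clear; lia.
have med s : Hen s <= h -> (L * K <= (npart s).*2 + m.*2)%N.
  move: lt; rewrite !HenE -(npart_chk false); clear; lia.
case/reachP: r => p [[_ [pp last_p]]]; rewrite maxH_le => /andP[_ hp].
have : e_side (chk K L false).
  split; first exact: chk_X.
  by left; split=> //; split; [exists c0|exists r0].
elim: p (chk K L false) pp last_p hp {lt med} (med) => [|z p IH] x /=.
  move=> _ -> _ _ [_ [[_ [[c /(_ r0)]]]|[]]]; last by rewrite lowc.
  by rewrite ffunE; case: (par _).
move=> /andP[xz zp] last_p /andP[hz hp] med ex.
by apply: (IH z) => //; apply: e_side_trans ex => //; exact: med.
Qed.
End Lower.

Theorem theorem5p3 (K L : nat) (hK : (2 <= K)%N) (hL : (2 <= L)%N) (hKe : ~~ odd K) :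
  tGamma (Xset K L :\: [set econf K L; oconf K L]) <= (minn K./2 L)%:Z /\
  GammaA (econf K L) [set oconf K L] = (minn K./2 L + 1)%N%:Z /\
  tGamma (Xset K L :\: [set oconf K L]) = (minn K./2 L + 1)%N%:Z.
Proof.
rewrite econfE oconfE PoszD; set e := chk K L false; set o := chk K L true.
have Xe : e \in Xset K L by exact: chk_X.
have Xo : o \in Xset K L by exact: chk_X.
have m0 : 0 <= (minn K./2 L)%:Z by [].
have e_min x : x \in Xset K L -> Hen e <= Hen x.
  by move=> /(npart_max hK hL hKe); rewrite -(npart_chk hK hL hKe false) -/e !HenE; lia.
have e_to_o := (reach_chk_min hK hL hKe Xe).1 true.
have to_eo x : x \in Xset K L -> reach (Hen x + (minn K./2 L)%:Z) x e \/
    reach (Hen x + (minn K./2 L)%:Z) x o.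
  by move=> /(reach_chk_min hK hL hKe)[_ [[]]]; [right|left].
have barrier := chk_barrier hK hL hKe.
(* The empty configuration witnesses that the set in the first claim is nonempty. *)
have ne0 b : conf0 K L != chk K L b.
  apply/eqP => E; have := npart_chk hK hL hKe b.
  rewrite -E /npart big1 => [|v _]; last by rewrite ffunE.
  have : (0 < L * K)%N by rewrite muln_gt0; lia.
  by case: (L * K)%N.
split; first exact: tGamma_eo Xe Xo to_eo (ne0 _) (ne0 _).
split; first exact: GammaA_eo Xe Xo m0 e_min e_to_o barrier to_eo.
exact: tGamma_o Xe Xo m0 e_min e_to_o barrier to_eo.
Qed.
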